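(* Let $\mathbb{F}$ be a field. For each integer $n\geq 0$ let $R(n)$ be a finite set, with $|R(0)|=1$, and let $C(n)$ be the set of compositions of $n$. For each $n\geq 0$ let $A_n$ be an $R(n)\times C(n)$ matrix and $B_n$ a $C(n)\times R(n)$ matrix with entries in $\mathbb{F}$, written $A(\lambda,\beta)=A_n(\lambda,\beta)$ and $B(\beta,\mu)=B_n(\beta,\mu)$, with $A_0=B_0=[1]$. Suppose that for each $n>0$, each $\lambda\in R(n)$ and each $L\in\{1,\dots,n\}$ there is a finite set $S(\lambda,L)\subseteq R(n-L)$ and weights $\mathrm{wt}_A(\lambda,\gamma)\in\mathbb{F}$ ($\gamma\in S(\lambda,L)$) such that for all $\lambda\in R(n)$ and $\beta\in C(n)$, $$A(\lambda,\beta)=\sum_{\gamma\in S(\lambda,L(\beta))}\mathrm{wt}_A(\lambda,\gamma)\,A(\gamma,\beta^* ),$$ and that for each $n>0$, $\mu\in R(n)$ and $L\in\{1,\dots,n\}$ there is a finite set $T(\mu,L)\subseteq R(n-L)$ and weights $\mathrm{wt}_B(\mu,\delta)\in\mathbb{F}$ ($\delta\in T(\mu,L)$) such that for all $\beta\in C(n)$ and $\mu\in R(n)$, $$B(\beta,\mu)=\sum_{\delta\in T(\mu,L(\beta))}\mathrm{wt}_B(\mu,\delta)\,B(\beta^*,\delta).$$ Then the family of identities $A_nB_n=I_{R(n)}$ for all $n\geq 0$ holds if and only if for all $n>0$ and all $\lambda,\mu\in R(n)$, $$\sum_{L=1}^n\ \sum_{\gamma\in S(\lambda,L)\cap T(\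mu,L)}\mathrm{wt}_A(\lambda,\gamma)\,\mathrm{wt}_B(\mu,\gamma)=\chi(\lambda=\mu).$$
   Context: A composition of $n$ is a finite list $\beta=(\beta_1,\dots,\beta_s)$ of positive integers with sum $n$; $C(0)$ consists of the empty list. For $\beta$ nonempty, $L(\beta)=\beta_s$ is its last part and $\beta^*=(\beta_1,\dots,\beta_{s-1})$ is its truncation (a composition of $n-\beta_s$). An $R\times C$ matrix is a function $R\times C\to\mathbb{F}$. $\chi(Q)$ is $1$ if statement $Q$ is true and $0$ otherwise; $I_R$ is the identity matrix indexed by $R$. *)

(* Defs.v *)
From HB Require Import structures.
From mathcomp Require Import all_boot all_algebra.

Set Implicit Arguments.
Unset Strict Implicit.
Unset Printing Implicit Defensive.

Import GRing.Theory.

Definition is_composition (n : nat) (s : seq nat) : bool :=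
  (0 \notin s) && (sumn s == n).

Record composition (n : nat) := Composition {
  parts :> seq nat;
  partsP : is_composition n parts
}.

HB.instance Definition _ (n : nat) := [isSub of composition n for @parts n].
HB.instance Definition _ (n : nat) := [Countable of composition n by <:].

(* Finiteness: a composition of n has at most n parts, each at most n. *)
Section CompositionFinite.

Variable n : nat.

Definition bseq_of_composition (b : composition n) : n.-bseq 'I_n.+1 :=
  insub_bseq n [seq inord k | k <- parts b].

Definition composition_of_bseq (t : n.-bseq 'I_n.+1) : option (composition n) :=
  insub [seq nat_of_ord k | k <- t].

Lemma composition_size (s : seq nat) : is_composition n s -> size s <= n.
Proof.
case/andP=> s0 /eqP <-; elim: s s0 => //= k s IHs.
rewrite inE negb_or eq_sym => /andP[k0 /IHs le_s].
by rewrite -addn1 addnC leq_add // lt0n.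
Qed.

Lemma composition_part_le (s : seq nat) (k : nat) :
  is_composition n s -> k \in s -> k <= n.
Proof.
case/andP=> _ /eqP <-; elim: s => //= j s IHs.
rewrite inE => /orP[/eqP->|/IHs le_k]; first exact: leq_addr.
exact: leq_trans le_k (leq_addl _ _).
Qed.

Lemma bseq_of_compositionK : pcancel bseq_of_composition composition_of_bseq.
Proof.
move=> b; rewrite /composition_of_bseq /bseq_of_composition /insub_bseq.
rewrite insubdK ?unfold_in /= ?size_map ?composition_size ?(valP b) //.
rewrite -map_comp map_id_in; first exact: valK.
by move=> k k_b /=; rewrite inordK // ltnS (composition_part_le (valP b)).
Qed.

HB.instance Definition _ :=
  isFinite.Build (composition n) (pcan_enumP bseq_of_compositionK).

End CompositionFinite.

(* The default value 0 is only reached by the empty composition (n = 0). *)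
Definition last_part (n : nat) (b : composition n) : nat := last 0 b.

Lemma truncation_proof (n : nat) (b : composition n) :
  is_composition (n - last_part b) (take (size b).-1 b).
Proof.
rewrite /last_part; case: b => s /= /andP[s0 /eqP <-].
case/lastP: s s0 => // s k; rewrite mem_rcons inE negb_or => /andP[_ s0].
by rewrite size_rcons /= last_rcons -cats1 take_size_cat // sumn_cat /= addn0
  addnK /is_composition s0 eqxx.
Qed.

Definition truncation (n : nat) (b : composition n) :
  composition (n - last_part b) := Composition (truncation_proof b).

Local Open Scope ring_scope.

Definition fmatrix (F : Type) (I J : finType) := {ffun I * J -> F}.

Definition fmatrix_mul (F : fieldType) (I J K : finType)
    (A : fmatrix F I J) (B : fmatrix F J K) : fmatrix F I K :=
  [ffun p => \sum_(j : J) A (p.1, j) * B (j, p.2)].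

Definition fmatrix_id (F : fieldType) (I : finType) : fmatrix F I I :=
  [ffun p => (p.1 == p.2)%:R].

(* Main.v *)
(* Sorting the compositions of n by their last part and expanding A and B by
   the recursions gives, for n > 0,
     (A_n B_n)(lam, mu) = \sum_L \sum_(g in S(lam, L)) \sum_(d in T(mu, L))
                            wtA(lam, g) wtB(mu, d) (A_(n-L) B_(n-L))(g, d).
   If the smaller products are identities, the right-hand side collapses to the
   sum over S(lam, L) :&: T(mu, L) of the local identity; the converse is then
   a strong induction on n. *)

Require Import Defs.
From mathcomp Require Import all_boot all_algebra.

Set Implicit Arguments.
Unset Strict Implicit.
Unset Printing Implicit Defensive.

Import GRing.Theory.
Local Open Scope ring_scope.

Lemma last_part_bounds (n : nat) (b : composition n) :
  (0 < n)%N -> (0 < last_part b <= n)%N.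
Proof.
rewrite /last_part; case: b => s /= /andP[s0 /eqP <-].
case/lastP: s s0 => // s k; rewrite mem_rcons inE negb_or eq_sym -lt0n.
by case/andP=> k0 _ _; rewrite last_rcons k0 sumn_rcons leq_addl.
Qed.

Lemma parts_truncation (n : nat) (b : composition n) : (0 < n)%N ->
  parts b = rcons (truncation b) (last_part b).
Proof.
rewrite /last_part; case: b => s /= /andP[_ /eqP <-].
case/lastP: s => // s k _.
by rewrite size_rcons /= last_rcons -cats1 take_size_cat ?cats1.
Qed.

Lemma rcons_is_composition (n L : nat) (c : composition (n - L)) :
  (0 < L <= n)%N -> is_composition n (rcons c L).
Proof.
case/andP=> L0 Ln; case: c => s /= /andP[s0 /eqP sn].
by rewrite /is_composition mem_rcons inE negb_or eq_sym -lt0n L0 s0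
  sumn_rcons sn subnK /=.
Qed.

Definition rcons_composition (n L : nat) (hL : (0 < L <= n)%N)
    (c : composition (n - L)) : composition n :=
  Composition (rcons_is_composition c hL).

(* Transport along [last_part b = L], which [f] depends on through its type. *)
Lemma truncation_rcons (T : Type) (n L : nat) (f : forall k, composition (n - k) -> T)
    (b : composition n) (c : composition (n - L)) :
  parts b = rcons c L -> f (last_part b) (truncation b) = f L c.
Proof.
move=> eq_b; have eqL : last_part b = L by rewrite /last_part eq_b last_rcons.
have: parts (truncation b) = parts c.
  by rewrite /= eq_b size_rcons -cats1 take_size_cat.
by move: (truncation b); rewrite eqL => c' /val_inj ->.
Qed.

(** For [n > 0], removing the last part is a bijection from compositions of [n] to pairs of some [L]
    in [1..n] and a composition of [n - L]. The summand takes [L] as an argument because the type of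
    the truncation depends on it. *)
Lemma sum_composition_last (V : nmodType) (n : nat)
    (f : forall L, composition (n - L) -> V) : (0 < n)%N ->
  \sum_(b : composition n) f (last_part b) (truncation b) =
  \sum_(1 <= L < n.+1) \sum_(c : composition (n - L)) f L c.
Proof.
move=> n0.
(* The inserted sum over [L] has exactly one term, as [n > 0] puts [last_part b] in the range. *)
transitivity (\sum_(b : composition n) \sum_(1 <= L < n.+1 | L == last_part b)
    f (last_part b) (truncation b)).
  by apply: eq_bigr => b _; rewrite big_nat1_eq ltnS last_part_bounds.
rewrite (exchange_big_dep xpredT) //=; apply: eq_big_nat => L; rewrite ltnS => hL.
(* The inverse of appending [L] is partial: for another last part, the truncation does not sum to
   [n - L], hence [insub]. *)
rewrite (reindex_omap (rcons_composition hL)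
  (fun b => insub (take (size b).-1 b))) => [|b /eqP eqL]; last first.
  have cP : is_composition (n - L) (take (size b).-1 b).
    by rewrite eqL truncation_proof.
  rewrite (insubT _ cP) /=; congr Some; apply: val_inj => /=.
  by rewrite eqL [RHS]parts_truncation.
apply: eq_big => [c|c _]; last exact: truncation_rcons.
rewrite /last_part /= last_rcons eqxx /= size_rcons -cats1 take_size_cat //.
by rewrite valK eqxx.
Qed.

(** Only the diagonal survives, so both indices lie in [S] and in [T]; this is where the
    intersection in the local identity comes from. *)
Lemma sum_mul_delta (K : pzSemiRingType) (I : finType) (S T : {set I}) (u v : I -> K) :
  \sum_(i in S) \sum_(j in T) u i * v j * (i == j)%:R =
  \sum_(i in S :&: T) u i * v i.
Proof.
rewrite [RHS](eq_bigl (fun i => (i \in S) && (i \in T))) => [|i]; last by rewrite inE.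
rewrite big_mkcondr; apply: eq_bigr => i _.
case: ifP => [iT|/negP iT].
  rewrite (bigD1 i) //= eqxx mulr1 big1 ?addr0 // => j /andP[_ ji].
  by rewrite eq_sym (negPf ji) mulr0.
apply: big1 => j jT; case: eqP => [ij|_]; last by rewrite mulr0.
by case: iT; rewrite ij.
Qed.

(* SA n lam L and TB n mu L are only constrained and only used for
   0 < n and 1 <= L <= n; their other values are irrelevant, and likewise
   for the weights outside SA and TB. *)
Theorem theorem2p2 (F : fieldType) (R : nat -> finType)
    (cardR0 : #|R 0%N| = 1%N)
    (A : forall n : nat, fmatrix F (R n) (composition n))
    (B : forall n : nat, fmatrix F (composition n) (R n))
    (A0 : forall (lam : R 0%N) (b : composition 0), A 0%N (lam, b) = 1)
    (B0 : forall (b : composition 0) (mu : R 0%N), B 0%N (b, mu) = 1)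
    (SA : forall n : nat, R n -> forall L : nat, {set R (n - L)%N})
    (wtA : forall n : nat, R n -> forall m : nat, R m -> F)
    (A_rec : forall (n : nat) (lam : R n) (b : composition n), (0 < n)%N ->
       A n (lam, b) =
       \sum_(g in SA n lam (last_part b))
          wtA n lam (n - last_part b)%N g *
          A (n - last_part b)%N (g, truncation b))
    (TB : forall n : nat, R n -> forall L : nat, {set R (n - L)%N})
    (wtB : forall n : nat, R n -> forall m : nat, R m -> F)
    (B_rec : forall (n : nat) (b : composition n) (mu : R n), (0 < n)%N ->
       B n (b, mu) =
       \sum_(d in TB n mu (last_part b))
          wtB n mu (n - last_part b)%N d *
          B (n - last_part b)%N (truncation b, d)) :
  (forall n : nat, fmatrix_mul (A n) (B n) = fmatrix_id F (R n)) <->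
  (forall (n : nat) (lam mu : R n), (0 < n)%N ->
     \sum_(1 <= L < n.+1)
       \sum_(g in SA n lam L :&: TB n mu L)
          wtA n lam (n - L)%N g * wtB n mu (n - L)%N g
     = (lam == mu)%:R).
Proof.
have prod_rec n lam mu : (0 < n)%N ->
    fmatrix_mul (A n) (B n) (lam, mu) =
    \sum_(1 <= L < n.+1) \sum_(g in SA n lam L) \sum_(d in TB n mu L)
      wtA n lam (n - L)%N g * wtB n mu (n - L)%N d *
      fmatrix_mul (A (n - L)%N) (B (n - L)%N) (g, d).
  move=> n0; rewrite ffunE /=.
  pose f L (c : composition (n - L)) :=
    (\sum_(g in SA n lam L) wtA n lam (n - L)%N g * A (n - L)%N (g, c)) *
    (\sum_(d in TB n mu L) wtB n mu (n - L)%N d * B (n - L)%N (c, d)).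
  transitivity (\sum_(b : composition n) f (last_part b) (truncation b)).
    by apply: eq_bigr => b _; rewrite A_rec // B_rec.
  rewrite sum_composition_last //; apply: eq_bigr => L _.
  (* Moving the sum over [c] innermost turns it into an entry of the product of size [n - L]. *)
  under [LHS]eq_bigr do rewrite /f big_distrlr /=.
  rewrite exchange_big; apply: eq_bigr => g _.
  rewrite exchange_big; apply: eq_bigr => d _.
  rewrite ffunE mulr_sumr; apply: eq_bigr => c _.
  by rewrite mulrACA.
(* Assuming identities only below [n] lets this serve both directions; [L >= 1] gives
   [n - L < n]. *)
have prod_local n lam mu : (0 < n)%N ->
    (forall m, (m < n)%N -> fmatrix_mul (A m) (B m) = fmatrix_id F (R m)) ->
    fmatrix_mul (A n) (B n) (lam, mu) =
    \sum_(1 <= L < n.+1) \sum_(g in SA n lam L :&: TB n mu L)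
      wtA n lam (n - L)%N g * wtB n mu (n - L)%N g.
  move=> n0 IH; rewrite prod_rec //; apply: eq_big_nat => L /andP[L0 _].
  rewrite IH ?ltn_subrL ?L0 // -sum_mul_delta.
  by apply: eq_bigr => g _; apply: eq_bigr => d _; rewrite ffunE.
split=> [AB1 n lam mu n0|loc n].
  by rewrite -prod_local // AB1 ffunE.
elim/ltn_ind: n => -[_|n IH]; apply/ffunP=> -[lam mu]; last first.
  by rewrite prod_local // loc // ffunE.
(* Base case: the product is 1 by 1, and its sum has the single term [1 * 1], indexed by the empty
   composition. *)
have R0 : lam = mu by have /fintype_le1P/(_ mu lam) := eq_leq cardR0.
have C0 (b : composition 0) : b = Composition (isT : is_composition 0 [::]).
  by apply: val_inj; case: b => s sP; apply/nilP; rewrite /nilp -leqn0 composition_size.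
rewrite !ffunE /= R0 eqxx (bigD1 (Composition (isT : is_composition 0 [::]))) //=.
by rewrite A0 B0 mulr1 big1 ?addr0 // => b; rewrite (C0 b) eqxx.
Qed.
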